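(* Let $r,s>0$ be integers. Every orbit $O=O(r,s)$ consists of a directed cycle $B=B(O)$, possibly degenerated into a point, to which disjoint trees are attached. If $|B|>1$, there is one tree attached to every node of $B$. If $|B|=1$, there are two trees attached to the unique node of $B$. Moreover, writing $\gcd(B)=2^{a}b$ with $b$ odd: (i) when $|O|>1$, each tree attached to $B$ is an extended complete binary tree of height $a$; (ii) $O=B=\{(2^{k}r \bmod (r+s),\,2^{k}s \bmod (r+s)) : k\geq 0\}$ if and only if $r+s$ is odd; (iii) $|O|=|B|2^{a}$ if $|B|>1$, and $|O|=2^{a+1}-1$ if $|B|=1$.
   Context: $\mathbb{N}^+$ is the set of positive integers. Consider the partial maps on $\mathbb{N}^+\times\mathbb{N}^+$: $\alpha(r,s)=(2r,s-r)$, defined iff $s>r$; $\beta(r,s)=(r-s,2s)$, defined iff $r>s$; $\gamma(r,s)=(r/2,s+r/2)$, defined iff $r$ is even; $\delta(r,s)=(r+s/2,s/2)$, defined iff $s$ is even. The orbit $O(r,s)$ is the set of all points $\varphi_k\varphi_{k-1}\cdots\varphi_1(r,s)$ with $k\ge 0$ and $\varphi_i\in\{\alpha,\beta,\gamma,\delta\}$ (whenever the composition is defined). The partial map $\omega$ on $\mathbb{N}^+\times\mathbb{N}^+$ is $\omega(r,s)=(2r \bmod (r+s),\,2s \bmod (r+s))$, defined iff $r\ne s$; it equals $\alpha$ when $r<s$ and $\beta$ when $r>s$. An orbit is regarded as a directed graph in which each arrow stands for a single application of $\omega$. The depth of a point $v=(r,s)$ is $\gcd(v)=\gcd(r,s)$;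 for a subset $V$ of an orbit, $\gcd(V)=\max_{v\in V}\gcd(v)$. The bottom $B(O)$ of an orbit $O$ is the set of all $v\in O$ of maximum depth. A rooted tree is called an extended complete binary tree if it is rooted at a node $\rho$ and consists of an edge $\rho t$ and a complete binary tree attached to $t$. The height of a rooted tree is the length of its longest branch.
   Formalization: In (i) a single node counts as an extended complete binary tree of height 0; with the literal definition (an edge ρt is required) claim (i) fails when r+s is odd, e.g. for (r,s)=(1,2), where |O|=2, a=0 and the trees are single nodes. *)

(* Defs.v *)
From mathcomp Require Import all_boot finmap.
From mathcomp Require Import all_classical.

Set Implicit Arguments.
Unset Strict Implicit.
Unset Printing Implicit Defensive.

Local Open Scope classical_set_scope.
Local Open Scope nat_scope.

(* Only meaningful when A is finite: fset_set A is empty otherwise. *)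
Definition ncard (T : choiceType) (A : set T) : nat := #|` fset_set A|%fset.

Section Digraphs.
Variables (T : choiceType) (e : rel T).
Implicit Types (V B O : set T) (u v rho t : T) (p : seq T).

(* [u :: p] is a directed walk of length [size p] from u to v in the digraph
   induced by e on V. *)
Definition walk V u p v : Prop :=
  [/\ path e u p, last u p = v & [set` u :: p] `<=` V].

Definition is_dicycle B : Prop :=
  exists2 c : seq T, uniq c /\ 1 < size c &
    B = [set` c] /\ forall u v, B u -> B v -> e u v = (v == next c u).

Definition is_degenerate_dicycle B : Prop := exists2 v, B = [set v] & ~~ e v v.

(* Trees are oriented towards their root, as the arcs of an orbit are; the
   case v = rho of the last clause excludes arcs of V leaving the root. *)
Definition rooted_tree V rho : Prop :=
  V rho /\ forall v, V v -> exists! p, walk V v p rho.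

Definition children V v : set T := [set u | V u /\ e u v].

Definition leaf V v : Prop := V v /\ children V v = set0.

Definition has_height V rho h : Prop :=
  (exists v p, walk V v p rho /\ size p = h) /\
  (forall v p, walk V v p rho -> size p <= h).

Definition complete_binary_tree V t : Prop :=
  [/\ finite_set V, rooted_tree V t,
      forall v, V v -> leaf V v \/ ncard (children V v) = 2
    & exists h, forall v p, leaf V v -> walk V v p t -> size p = h].

(* The first alternative is the extended complete binary tree of height 0, in
   which the complete binary tree attached to the root is empty. *)
Definition extended_complete_binary_tree V rho : Prop :=
  rooted_tree V rho /\
  (V = [set rho] \/
   exists t W, [/\ V = rho |` W, ~ W rho, e t rho & complete_binary_tree W t]).

(* The digraph induced by e on O is the union of the cycle B and of the trees
   induced on the sets tree i, the i-th one being attached to B at its root.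
   Distinct trees are disjoint, except that they share their root if they are
   attached to the same node of B. *)
Record cycle_with_trees O B (k : nat) (root : 'I_k -> T)
    (tree : 'I_k -> set T) : Prop := CycleWithTrees {
  cwt_cycle : is_dicycle B \/ is_degenerate_dicycle B;
  cwt_tree : forall i, rooted_tree (tree i) (root i);
  cwt_attached : forall i, tree i `&` B = [set root i];
  cwt_disjoint : forall i j, i != j -> tree i `&` tree j `<=` B;
  cwt_vertices : O = B `|` \bigcup_i tree i;
  cwt_arcs : forall u v, O u -> O v -> e u v ->
    (B u /\ B v) \/ exists i, tree i u /\ tree i v
}.

End Digraphs.

(* The partial maps are only intended on pairs of positive integers. They map
   such pairs to such pairs, so that no zero coordinate occurs in the orbit of
   a pair of positive integers. *)
Definition npoint : choiceType := (nat * nat)%type.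

Definition alpha (v : npoint) : option npoint :=
  let: (r, s) := v in if r < s then Some (2 * r, s - r) else None.

Definition beta (v : npoint) : option npoint :=
  let: (r, s) := v in if s < r then Some (r - s, 2 * s) else None.

Definition gamma (v : npoint) : option npoint :=
  let: (r, s) := v in if ~~ odd r then Some (r %/ 2, s + r %/ 2) else None.

Definition delta (v : npoint) : option npoint :=
  let: (r, s) := v in if ~~ odd s then Some (r + s %/ 2, s %/ 2) else None.

Definition omega (v : npoint) : option npoint :=
  let: (r, s) := v in
  if r != s then Some ((2 * r) %% (r + s), (2 * s) %% (r + s)) else None.

Inductive generator := Alpha | Beta | Gamma | Delta.

Definition generator_map (g : generator) : npoint -> option npoint :=
  match g with
  | Alpha => alpha | Beta => beta | Gamma => gamma | Delta => delta
  end.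

(* apply_word [:: phi_1; phi_2; ...] v applies phi_1 first. *)
Definition apply_word (w : seq generator) (v : npoint) : option npoint :=
  foldl (fun o g => obind (generator_map g) o) (Some v) w.

Definition orbit_set (v : npoint) : set npoint :=
  [set u | exists w, apply_word w v = Some u].

Definition omega_arc : rel npoint := fun u v => omega u == Some v.

Definition depth (v : npoint) : nat := gcdn v.1 v.2.

(* As ncard, only meaningful for finite sets. *)
Definition max_depth (V : set npoint) : nat := \max_(v <- fset_set V) depth v.

Definition bottom (O : set npoint) : set npoint :=
  [set v | O v /\ forall u, O u -> depth u <= depth v].

(* Main.v *)
Require Import Defs.
From mathcomp Require Import all_boot finmap.
From mathcomp Require Import all_classical.
From mathcomp Require Import cyclic zify.

Set Implicit Arguments.
Unset Strict Implicit.
Unset Printing Implicit Defensive.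

(** On the positive points of the line x + y = n, n = r + s, the map omega is
    doubling modulo n, undefined only at (n/2, n/2). The partial maps gamma and
    delta are the two branches of its inverse: gamma undoes alpha and delta
    undoes beta ([omega_arc_preimages]). So an orbit is a connected component
    of the graph of omega, and whatever is invariant along the arcs of omega
    is constant on it ([orbit_ind]).

    Write n = 2^m q with q odd. The depth of (x, y) is gcd(x, n), and doubling
    raises its 2-adic valuation by one, up to the ceiling m, and keeps its odd
    part ([depth_arc]); let b be this odd part, which divides q. If b < q, the
    point (n/2, n/2) is not in the orbit, so the valuation climbs to a = m. If
    b = q, it stops at (n/2, n/2), where it is a = m - 1. In both cases the
    bottom is the set of points of valuation a, and the level h of a point, the
    number of steps from it to the bottom, is a minus the valuation of its
    depth. A point of level less than a has even coordinates, hence two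
    preimages, one level higher when the point is not in the bottom; a point
    of level a > 0 has odd coordinates, hence no preimage. This is the content
    of [orbit_levelled_forest], and it alone determines the trees: the
    points leading to a given point of level 1 form a complete binary tree of
    height a - 1 ([complete_descendants]) with 2^a - 1 nodes
    ([ncard_descendants]).

    It remains to understand the bottom. If b = q it is the point (n/2, n/2)
    ([bottom_point]); both its preimages have level 1 when a > 0, which gives
    two trees. If b < q, doubling acts on the bottom as on residues modulo q,
    where it is periodic by Euler's theorem ([cycle_periodic]); connectedness of
    the orbit makes the bottom a single cycle ([cycle_bottom]). By periodicity
    exactly one of the two preimages of a node of the cycle lies on the cycle,
    so when a > 0 exactly one has level 1 ([cycle_stem]), and one tree is
    attached to every node. The cardinality of the orbit is that of the bottom
    plus 2^a - 1 for each tree. *)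

Local Open Scope classical_set_scope.
Local Open Scope nat_scope.

(** * Cardinality of classical sets *)

Lemma ncard_set1 (T : choiceType) (x : T) : ncard [set x] = 1.
Proof. by rewrite /ncard fset_set1 cardfs1. Qed.

Lemma ncardU (T : choiceType) (A B : set T) :
  finite_set A -> finite_set B -> A `&` B = set0 ->
  ncard (A `|` B) = ncard A + ncard B.
Proof.
move=> finA finB AB0.
by rewrite /ncard fset_setU // -cardfsUI -fset_setI // AB0 fset_set0 cardfs0 addn0.
Qed.

Lemma set_seq_cons (T : choiceType) (x : T) (s : seq T) :
  [set` x :: s] = x |` [set` s].
Proof.
apply/seteqP; split=> y /=; rewrite inE.
  by case/orP=> [/eqP->|]; [left|right].
by case=> [->|->]; rewrite ?eqxx ?orbT.
Qed.

Lemma ncard_seq (T : choiceType) (s : seq T) : uniq s -> ncard [set` s] = size s.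
Proof.
elim: s => [_|x s IHs /= /andP[xs us]].
  by rewrite set_nil /ncard fset_set0 cardfs0.
rewrite set_seq_cons ncardU ?ncard_set1 ?IHs //.
by apply/seteqP; split=> // y /= [-> ]; rewrite (negPf xs).
Qed.

Lemma ncard_bigcup (I T : choiceType) (s : seq I) (F : I -> set T) c :
  uniq s -> (forall i, finite_set (F i)) -> (forall i, ncard (F i) = c) ->
  (forall i j, i != j -> F i `&` F j = set0) ->
  ncard (\bigcup_(i in [set` s]) F i) = size s * c.
Proof.
move=> us finF cardF disF; elim: s us => [_|x s IHs /= /andP[xs us]].
  by rewrite set_nil bigcup_set0 /ncard fset_set0 cardfs0.
rewrite set_seq_cons bigcup_setU1 ncardU ?cardF ?IHs ?mulSn //.
  exact: bigcup_finite.
apply/seteqP; split=> // y /= [Fxy [i /= si Fiy]].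
have nxi : x != i by apply: contraNneq xs => ->.
by have : (F x `&` F i) y by []; rewrite disF.
Qed.

(** * Functional graphs graded by the distance to a bottom level *)

(** [h] is the distance to the bottom [h = 0], and [f] is the function whose
    graph is [e], but only off the bottom. Arcs that start on the
    bottom need not follow [f], so that the same structure covers a bottom that
    is a cycle and a bottom that is a point with no outgoing arc. *)
Record levelled_forest (T : choiceType) (e : rel T) (f : T -> T) (h : T -> nat)
    (a : nat) (O : set T) : Prop := LevelledForest {
  lf_finite : finite_set O;
  lf_up : forall v, O v -> 0 < h v -> O (f v) /\ h (f v) = (h v).-1;
  lf_arc : forall u v, O u -> O v -> 0 < h u -> e u v = (v == f u);
  lf_ground : forall u v, O u -> O v -> h u = 0 -> e u v -> h v = 0;
  lf_irrefl : forall u, O u -> ~~ e u u;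
  lf_height : forall v, O v -> h v <= a;
  lf_fork : forall v, O v -> h v < a ->
    exists u w, u <> w /\ children e O v = [set u; w]
}.

Section LevelledForest.
Variables (T : choiceType) (e : rel T) (f : T -> T) (h : T -> nat) (a : nat).
Variable O : set T.
Hypothesis forestO : levelled_forest e f h a O.
Implicit Types (V : set T) (t u v w rho : T) (p : seq T).

Lemma iter_up v k : O v -> k <= h v ->
  O (iter k f v) /\ h (iter k f v) = h v - k.
Proof.
move=> Ov; elim: k => [|j IHj] lej /=; first by rewrite subn0.
have [Oj hj] := IHj (ltnW lej).
have [|? ->] := lf_up forestO Oj; [lia|split=> //; lia].
Qed.

Lemma child_above u v : O u -> O v -> 0 < h v -> e u v -> v = f u /\ h u = (h v).+1.
Proof.
move=> Ou Ov hv euv; have [hu0|hu] := posnP (h u).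
  by rewrite (lf_ground forestO Ou Ov hu0 euv) in hv.
have vE : v = f u by apply/eqP; rewrite -(lf_arc forestO).
by split=> //; rewrite vE (lf_up forestO Ou hu).2; lia.
Qed.

(** If no arc of [V] starts on the bottom, a walk in [V] follows [f], one level
    down at each step. It is therefore determined by its endpoints, which gives
    the uniqueness in [rooted_tree]. *)
Lemma walk_levels V u p v :
  V `<=` O -> (forall x y, V x -> V y -> e x y -> 0 < h x) -> walk e V u p v ->
  h u = size p + h v /\ p = traject f (f u) (size p).
Proof.
move=> VO Vpos; elim: p u => [|x p IHp] u [/= + + sub].
  by move=> _ ->.
case/andP=> eux pth lst.
have Vu : V u by apply: sub; rewrite /= inE eqxx.
have Vx : V x by apply: sub; rewrite /= !inE eqxx orbT.
have hu := Vpos _ _ Vu Vx eux.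
have xE : x = f u by apply/eqP; rewrite -(lf_arc forestO) //; apply: VO.
have [|hx pE] := IHp x.
  by split=> // y yp; apply: sub; rewrite /= inE; apply/orP; right.
have := (lf_up forestO (VO _ Vu) hu).2; rewrite -xE hx => hE.
by split=> /=; [lia|rewrite -pE].
Qed.

(** The existence of the walks to the root required by [rooted_tree]. *)
Lemma walk_climb V rho :
  V `<=` O -> (forall v, V v -> v = rho \/ h rho < h v /\ V (f v)) ->
  forall v, V v -> walk e V v (traject f (f v) (h v - h rho)) rho.
Proof.
move=> VO up v; move En : (h v - h rho) => n; elim: n v En => [|n IHn] v En Vv.
  by case: (up v Vv) => [<-|]; [split=> // y /=; rewrite inE => /eqP->|lia].
have [vE|[ltv Vfv]] := up v Vv; first by move: En; rewrite vE subnn.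
have [Ofv hfv] := lf_up forestO (VO _ Vv) (leq_ltn_trans (leq0n _) ltv).
have [|pth lst sub] := IHn (f v) _ Vfv; first by lia.
split=> //=.
  by rewrite (lf_arc forestO) ?eqxx //; [exact: VO|lia].
by move=> y /=; rewrite inE => /orP[/eqP->//|]; apply: sub.
Qed.

Lemma rooted_tree_climb V rho :
  V `<=` O -> V rho -> (forall x y, V x -> V y -> e x y -> 0 < h x) ->
  (forall v, V v -> v = rho \/ h rho < h v /\ V (f v)) -> rooted_tree e V rho.
Proof.
move=> VO Vrho Vpos up; split=> // v Vv.
exists (traject f (f v) (h v - h rho)); split; first exact: walk_climb.
move=> p /(walk_levels VO Vpos)[hv ->]; congr traject; lia.
Qed.

(** The points from which [f] leads to [t] in as many steps as there are levels
    between them. The condition [0 < h t] discards a [t] on the bottom, where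
    [f] may lead round a cycle. *)
Definition descendants t : set T :=
  [set u | [/\ O u, 0 < h t <= h u & iter (h u - h t) f u = t]].

Lemma descendants_sub t : descendants t `<=` O.
Proof. by move=> u []. Qed.

Lemma descendants_pos t u : descendants t u -> 0 < h u.
Proof. by case=> _; lia. Qed.

Lemma finite_descendants t : finite_set (descendants t).
Proof. exact: sub_finite_set (@descendants_sub t) (lf_finite forestO). Qed.

Lemma descendants_self t : O t -> 0 < h t -> descendants t t.
Proof. by move=> Ot ht; split; rewrite ?ht ?leqnn ?subnn. Qed.

Lemma descendants_up t v :
  descendants t v -> v = t \/ h t < h v /\ descendants t (f v).
Proof.
case=> Ov /andP[ht]; rewrite leq_eqVlt => /orP[/eqP hE|lthv itE].
  by rewrite hE subnn /= => ->; left.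
right; split=> //; have [Ofv hfv] := lf_up forestO Ov (leq_ltn_trans (leq0n _) lthv).
split; rewrite ?hfv //; first by lia.
by rewrite -[RHS]itE -iterSr; congr (iter _ f v); lia.
Qed.

Lemma descendants_child t u v :
  descendants t v -> O u -> e u v -> descendants t u.
Proof.
move=> Dv Ou euv; have [Ov hv itE] := Dv.
have [vE hu] := child_above Ou Ov (descendants_pos Dv) euv.
split=> //; first by lia.
by rewrite (_ : h u - h t = (h v - h t).+1) ?iterSr -?vE //; lia.
Qed.

(** The node [t] splits into the two subtrees rooted at its children; both
    the cardinality and the shape of the tree come from this. *)
Lemma descendants_rec t u w :
  O t -> 0 < h t -> children e O t = [set u; w] ->
  descendants t = t |` (descendants u `|` descendants w).
Proof.
move=> Ot ht chE.
have childE x : O x -> e x t -> x = u \/ x = w.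
  by move=> Ox ext; have : children e O t x by []; rewrite chE.
have childP x : x = u \/ x = w -> descendants x `<=` descendants t.
  move=> xuw y [Oy hy itE]; have : children e O t x by rewrite chE.
  case=> Ox /(child_above Ox Ot ht)[tE hx].
  split=> //; first by lia.
  by rewrite [RHS]tE -itE -iterS; congr (iter _ f y); lia.
apply/seteqP; split=> [v|v [->|[]]]; last 3 first.
- exact: descendants_self.
- by apply: childP; left.
- by apply: childP; right.
case=> Ov /andP[_]; rewrite leq_eqVlt => /orP[/eqP hE|lthv itE].
  by rewrite -hE subnn /= => ->; left.
(* x is the last point before t on the way down from v. *)
right; pose x := iter (h v - (h t).+1) f v.
have [Ox hx] : O x /\ h x = (h t).+1.
  by have [|? ->] := @iter_up v (h v - (h t).+1) Ov; [lia|split=> //; lia].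
have fx : f x = t by rewrite -iterS -[RHS]itE; congr (iter _ f v); lia.
have Dx : descendants x v by split; rewrite ?hx.
have : x = u \/ x = w.
  by apply: childE => //; rewrite (lf_arc forestO) ?fx ?eqxx // hx.
by case=> <-; [left|right].
Qed.

Lemma forkP t : O t -> h t < a ->
  exists u w, [/\ u <> w, children e O t = [set u; w], children e O t u
    & children e O t w].
Proof.
move=> Ot /(lf_fork forestO Ot)[u [w [uw chE]]]; exists u, w.
by split=> //; rewrite chE; [left|right].
Qed.

Lemma ncard_descendants t :
  O t -> 0 < h t -> ncard (descendants t) = 2 ^ (a - h t).+1 - 1.
Proof.
move En : (a - h t) => n; elim: n t En => [|n IHn] t En Ot ht.
  rewrite (_ : descendants t = [set t]) ?ncard_set1 //.
  apply/seteqP; split=> [v [Ov hv]|v ->]; last exact: descendants_self.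
  have -> : h v - h t = 0 by have := lf_height forestO Ov; lia.
  by move=> /= ->.
have [|u [w [uw chE [Ou eut] [Ow ewt]]]] := forkP Ot; first by lia.
have [uE hu] := child_above Ou Ot ht eut.
have [wE hw] := child_above Ow Ot ht ewt.
have finD := finite_descendants.
have dis_uw : descendants u `&` descendants w = set0.
  apply/seteqP; split=> // v [[_ _ itu] [_ _ itw]]; apply: uw.
  by rewrite -itu -itw hu hw.
have dis_t : [set t] `&` (descendants u `|` descendants w) = set0.
  by apply/seteqP; split=> // v [->] [] [_ ]; lia.
rewrite (descendants_rec Ot ht chE) !ncardU ?finite_setU // ncard_set1.
by rewrite !IHn ?hu ?hw // ?expnS; have := expn_gt0 2 n; lia.
Qed.

(** All levels between that of [t] and [a] are inhabited, since every point
    of level less than [a] has a child. *)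
Lemma descendants_level t n :
  O t -> 0 < h t -> h t + n <= a -> exists2 v, descendants t v & h v = h t + n.
Proof.
move=> Ot ht; elim: n => [|n IHn] lea.
  by exists t; rewrite ?addn0 //; apply: descendants_self.
have [|v Dv hv] := IHn; first by lia.
have Ov := descendants_sub Dv.
have [|u [_ [_ _ [Ou euv] _]]] := forkP Ov; first by lia.
exists u; first exact: descendants_child Dv Ou euv.
by have [_ ->] := child_above Ou Ov (descendants_pos Dv) euv; lia.
Qed.

(** Inside the subtree the children are the same as in [O], so there are two of
    them at levels less than [a] and none at level [a]: the leaves are the
    points of level [a]. *)
Lemma complete_descendants t :
  O t -> 0 < h t -> complete_binary_tree e (descendants t) t.
Proof.
move=> Ot ht.
have Dpos x y : descendants t x -> descendants t y -> e x y -> 0 < h x.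
  by move=> /descendants_pos.
have chD v : descendants t v -> children e (descendants t) v = children e O v.
  move=> Dv; apply/seteqP; split=> u [].
    by move=> /descendants_sub Ou euv.
  by move=> Ou euv; split=> //; apply: descendants_child Dv Ou euv.
split.
- exact: finite_descendants.
- apply: rooted_tree_climb Dpos _; [exact: descendants_sub|..].
    exact: descendants_self.
  exact: descendants_up.
- move=> v Dv; have Ov := descendants_sub Dv.
  have := lf_height forestO Ov; rewrite leq_eqVlt => /orP[/eqP ha|lta].
    left; split=> //; rewrite chD //; apply/seteqP; split=> // u [Ou euv].
    have [_ hu] := child_above Ou Ov (descendants_pos Dv) euv.
    have := lf_height forestO Ou; lia.
  right; have [u [w [uw chE _ _]]] := forkP Ov lta.
  rewrite chD // chE ncardU ?ncard_set1 //.
  by apply/seteqP; split=> // x [-> /uw].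
exists (a - h t) => v p [Dv lv] /(walk_levels (@descendants_sub t) Dpos)[hv _].
suff : h v = a by lia.
apply/eqP; have Ov := descendants_sub Dv.
rewrite eqn_leq (lf_height forestO) //= leqNgt; apply/negP => /(forkP Ov).
by case=> u [w [_ _ Cu _]]; rewrite -chD // lv in Cu.
Qed.

(** When [a = 0] this is the one-point tree, whatever [t] is
    ([branch_eq0]); the value of [t] matters only for [a > 0]. *)
Definition branch rho t : set T := rho |` descendants t.

Lemma branch_eq0 rho t : a = 0 -> branch rho t = [set rho].
Proof.
move=> a0; rewrite /branch (_ : descendants t = set0) ?setU0 //.
by apply/seteqP; split=> // v [/(lf_height forestO)]; lia.
Qed.

Lemma branch_tree rho t : O rho -> h rho = 0 ->
  (0 < a -> [/\ O t, h t = 1 & f t = rho]) ->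
  [/\ rooted_tree e (branch rho t) rho,
      extended_complete_binary_tree e (branch rho t) rho
    & has_height e (branch rho t) rho a].
Proof.
move=> Orho hrho tP.
have subO : branch rho t `<=` O by move=> v [->//|]; apply: descendants_sub.
have pos x y : branch rho t x -> branch rho t y -> e x y -> 0 < h x.
  case=> [->|/descendants_pos//] Vy erhoy.
  have Oy := subO _ Vy; have := lf_ground forestO Orho Oy hrho erhoy.
  case: Vy => [yE|/descendants_pos]; last by lia.
  by move: erhoy; rewrite yE (negPf (lf_irrefl forestO Orho)).
have rooted : rooted_tree e (branch rho t) rho.
  apply: rooted_tree_climb => //; first by left.
  move=> v [->|Dv]; first by left.
  right; rewrite hrho (descendants_pos Dv); split=> //.
  have [|Ot ht ftE] := tP.
    exact: leq_trans (descendants_pos Dv) (lf_height forestO (descendants_sub Dv)).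
  by case: (descendants_up Dv) => [->|[_ Dfv]]; [left|right].
split=> //.
  split=> //; have [a0|a_gt0] := posnP a; first by left; exact: branch_eq0.
  have [Ot ht ftE] := tP a_gt0; right; exists t, (descendants t); split=> //.
  - by move=> /descendants_pos; rewrite hrho.
  - by rewrite (lf_arc forestO) ?ftE ?eqxx ?ht.
  - by apply: complete_descendants; rewrite ?ht.
split.
  have [v Vv hv] : exists2 v, branch rho t v & h v = a.
    have [a0|a_gt0] := posnP a; first by exists rho; [left|rewrite hrho].
    have [Ot ht ftE] := tP a_gt0.
    have [|||v Dv hv] := @descendants_level t a.-1; rewrite ?ht //; first by lia.
    by exists v; [right|lia].
  have [_ /(_ v Vv)[p [wp _]]] := rooted.
  by exists v, p; split=> //; have [+ _] := walk_levels subO pos wp; lia.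
move=> v p wp; have [+ _] := walk_levels subO pos wp.
have Ov : O v by case: wp => _ _ sub; apply/subO/sub; rewrite /= inE eqxx.
by have := lf_height forestO Ov; lia.
Qed.

Let B := [set v | O v /\ h v = 0].

(** When [a > 0], the stems are the points of level 1, one for each tree, and
    the roots are their images on the bottom, where one root may carry several
    trees. *)
Section Stems.
Variables (k : nat) (root stem : 'I_k -> T).
Hypothesis rootP : forall i, O (root i) /\ h (root i) = 0.
Hypothesis stemP : 0 < a -> forall i,
  [/\ O (stem i), h (stem i) = 1 & f (stem i) = root i].
Hypothesis stem_inj : 0 < a -> injective stem.
Hypothesis stem_cover : forall v, O v -> h v = 1 -> exists i, v = stem i.

Lemma descendants_stem v : O v -> 0 < h v -> exists i, descendants (stem i) v.
Proof.
move=> Ov hv; have [|Ow hw] := @iter_up v (h v).-1 Ov; first by lia.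
have [|i iE] := stem_cover Ow; first by lia.
exists i; rewrite -iE; split; rewrite // ?hw; first by lia.
by congr (iter _ f v); lia.
Qed.

Lemma descendants_stem_disjoint i j v :
  descendants (stem i) v -> descendants (stem j) v -> i = j.
Proof.
move=> Div Djv; have a_gt0 : 0 < a.
  exact: leq_trans (descendants_pos Div) (lf_height forestO (descendants_sub Div)).
case: Div => _ _ iti; case: Djv => _ _ itj; apply: stem_inj => //.
by have [_ hi _] := stemP a_gt0 i; have [_ hj _] := stemP a_gt0 j;
  rewrite -iti -itj hi hj.
Qed.

Lemma forest_cycle_with_trees : is_dicycle e B \/ is_degenerate_dicycle e B ->
  cycle_with_trees e O B root (fun i => branch (root i) (stem i)).
Proof.
move=> cycB; have stemB i : 0 < a -> _ := fun a_gt0 => stemP a_gt0 i.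
split=> //.
- by move=> i; have [Or hr] := rootP i; have [] := branch_tree Or hr (stemB i).
- move=> i; have [Or hr] := rootP i; apply/seteqP; split=> [v|v ->]; last first.
    by split=> //; left.
  by case=> -[//|/descendants_pos + [_ +]]; lia.
- move=> i j ij v [[->|Div]]; first by have := rootP i.
  case=> [->|Djv]; first by have := rootP j.
  by rewrite (descendants_stem_disjoint Div Djv) eqxx in ij.
- apply/seteqP; split=> [v Ov|v [[]//|[i _ [->|/descendants_sub//]]]]; last first.
    by case: (rootP i).
  have [hv|hv] := posnP (h v); first by left.
  by have [i Div] := descendants_stem Ov hv; right; exists i => //; right.
move=> u v Ou Ov euv; have [hu|hu] := posnP (h u).
  by left; split=> //; split=> //; apply: (lf_ground forestO) euv.
right; have [i Diu] := descendants_stem Ou hu; exists i; split; first by right.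
have a_gt0 : 0 < a by exact: leq_trans hu (lf_height forestO Ou).
have -> : v = f u by apply/eqP; rewrite -(lf_arc forestO).
case: (descendants_up Diu) => [->|[_ Dfu]]; last by right.
by have [_ _ ->] := stemP a_gt0 i; left.
Qed.

(** Each tree contributes its nodes other than its root. *)
Lemma ncard_forest : ncard O = ncard B + k * (2 ^ a - 1).
Proof.
have finB : finite_set B by apply: sub_finite_set (lf_finite forestO) => v [].
have [a0|a_gt0] := posnP a.
  rewrite a0 subnn muln0 addn0; congr ncard; apply/seteqP; split=> [v Ov|v []//].
  by split=> //; have := lf_height forestO Ov; lia.
have -> : O = B `|` \bigcup_(i in [set` enum 'I_k]) descendants (stem i).
  apply/seteqP; split=> [v Ov|v [[]//|[i _ /descendants_sub//]]].
  have [hv|hv] := posnP (h v); first by left.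
  have [i Div] := descendants_stem Ov hv; right; exists i => //=.
  by rewrite mem_enum.
rewrite ncardU //.
- congr (_ + _); rewrite (@ncard_bigcup _ _ _ _ (2 ^ a - 1)) ?enum_uniq //.
  + by rewrite size_enum_ord.
  + by move=> i; apply: finite_descendants.
  + move=> i; have [Os hs _] := stemP a_gt0 i.
    by rewrite ncard_descendants ?hs //; congr (2 ^ _ - 1); lia.
  + move=> i j ij; apply/seteqP; split=> // v [Div Djv].
    by rewrite (descendants_stem_disjoint Div Djv) eqxx in ij.
- by apply: bigcup_finite => // i _; apply: finite_descendants.
by apply/seteqP; split=> // v [[_ hv] [i _ /descendants_pos]]; lia.
Qed.

End Stems.
End LevelledForest.

(** * The map omega and its inverse branches *)

Definition doubling (n : nat) (v : npoint) : npoint :=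
  ((2 * v.1) %% n, (2 * v.2) %% n).

Lemma iter_doubling n j (v : npoint) : v.1 < n -> v.2 < n ->
  iter j (doubling n) v = ((2 ^ j * v.1) %% n, (2 ^ j * v.2) %% n).
Proof.
move=> v1 v2; elim: j => [|j /= ->].
  by rewrite /= !mul1n !modn_small //; case: v {v1 v2}.
by rewrite /doubling /= !modnMmr !mulnA -expnS.
Qed.

Definition positive (v : npoint) : bool := (0 < v.1) && (0 < v.2).

Lemma omegaE v :
  omega v = if v.1 != v.2 then Some (doubling (v.1 + v.2) v) else None.
Proof. by case: v. Qed.

Lemma omega_alpha_beta v : positive v ->
  omega v = if v.1 < v.2 then alpha v else beta v.
Proof.
case: v => x y /andP[/= x0 y0]; rewrite /omega /alpha /beta.
case: ltngtP => xy //=; congr (Some (_, _)).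
- by rewrite modn_small //; lia.
- by rewrite (_ : 2 * y = y - x + (x + y)) ?modnDr ?modn_small //; lia.
- by rewrite (_ : 2 * x = x - y + (x + y)) ?modnDr ?modn_small //; lia.
- by rewrite modn_small //; lia.
Qed.

(** The values of gamma and delta where these are defined. *)
Definition gamma_val (v : npoint) : npoint := (v.1 %/ 2, v.2 + v.1 %/ 2).
Definition delta_val (v : npoint) : npoint := (v.1 + v.2 %/ 2, v.2 %/ 2).

(** The arcs into [v] come from inverting alpha and beta: (2x, y - x) = v gives
    the value of gamma at [v], and (x - y, 2y) = v that of delta. *)
Lemma omega_arc_preimages u v : positive u -> positive v ->
  omega_arc u v =
    (~~ odd v.1 && (u == gamma_val v)) || (~~ odd v.2 && (u == delta_val v)).
Proof.
rewrite /omega_arc => pu pv; rewrite omega_alpha_beta //.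
case: u v pu pv => [x y] [z w] /andP[/= x0 y0] /andP[/= z0 w0].
rewrite /alpha /beta /gamma_val /delta_val /= !xpair_eqE.
case: ltngtP => xy /=; rewrite /eq_op /= ?xpair_eqE; lia.
Qed.

Lemma omega_arc_positive u v : positive u -> omega_arc u v ->
  positive v /\ u.1 + u.2 = v.1 + v.2.
Proof.
rewrite /omega_arc => pu; rewrite omega_alpha_beta //.
case: u v pu => [x y] [z w] /andP[/= x0 y0]; rewrite /alpha /beta /positive /=.
by case: ltngtP => xy //= /eqP[<- <-]; lia.
Qed.

Lemma omega_arc_doubling u v : omega_arc u v -> v = doubling (u.1 + u.2) u.
Proof. by rewrite /omega_arc omegaE; case: ifP => // _ /eqP[]. Qed.

(** Every generator follows an arc of omega forwards or backwards, and
    [arc_generators] is the converse: orbits are connected components. *)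
Lemma generator_arc g u v : positive u -> generator_map g u = Some v ->
  positive v /\ (omega_arc u v \/ omega_arc v u).
Proof.
move=> pu guv.
have pv : positive v.
  case: u v pu guv => [x y] [z w] /andP[/= x0 y0].
  case: g; rewrite /= /positive /=; case: ifP => //= ? [<- <-]; lia.
split=> //; case: g guv => guv.
- left; rewrite /omega_arc omega_alpha_beta // -guv.
  by move: guv; case: (u) => x y /=; case: ifP => //= ->.
- left; rewrite /omega_arc omega_alpha_beta // -guv.
  by move: guv; case: (u) => x y /=; case: (ltngtP x y) => //=.
- right; rewrite omega_arc_preimages //; move: guv; case: (u) => x y /=.
  by case: (odd x) => //= -[<-]; rewrite eqxx.
- right; rewrite omega_arc_preimages //; move: guv; case: (u) => x y /=.
  by case: (odd y) => //= -[<-]; rewrite eqxx orbT.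
Qed.

Lemma arc_generators u v : positive u -> omega_arc u v ->
  (exists g, generator_map g u = Some v) /\ (exists g, generator_map g v = Some u).
Proof.
move=> pu uv; have [pv _] := omega_arc_positive pu uv; split.
  move: uv; rewrite /omega_arc omega_alpha_beta //.
  by case: ifP => _ /eqP uv; [exists Alpha|exists Beta].
move: uv; rewrite omega_arc_preimages // => /orP[/andP[ev /eqP->]|/andP[ev /eqP->]].
  by exists Gamma; move: ev; case: (v) => x y /= ->.
by exists Delta; move: ev; case: (v) => x y /= ->.
Qed.

Lemma odd_part_double x : 0 < x -> (2 * x)`_2^' = x`_2^'.
Proof. by move=> x0; rewrite partnM // part_p'nat ?mul1n // pnatE. Qed.

(** The iterates of a periodic point, listed up to the least period, are
    pairwise distinct: two equal ones would close up earlier. *)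
Lemma periodic_orbit_cycle (T : choiceType) (f : T -> T) (y : T) K :
  0 < K -> iter K f y = y ->
  exists c : seq T, [/\ uniq c, fcycle f c &
    forall v, v \in c <-> exists k, v = iter k f y].
Proof.
move=> K0 itK; have exP : exists p, (0 < p) && (iter p f y == y).
  by exists K; rewrite K0 itK eqxx.
case: (ex_minnP exP) => -[//|p] /andP[_ /eqP itp] minp.
have cyc : fcycle f (traject f y p.+1).
  rewrite trajectS /= -[X in rcons _ X]itp iterSr -trajectSr.
  exact: fpath_traject.
exists (traject f y p.+1); split=> //.
  rewrite looping_uniq; apply/negP => /trajectP[i ltip itE].
  have /minp : (0 < i.+1) && (iter i.+1 f y == y).
    by rewrite iterS -itE -iterS itp eqxx.
  by rewrite ltnS leqNgt ltip.
move=> v; split=> [/trajectP[k _ ->]|[k ->]]; first by exists k.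
elim: k => [|k IHk]; first by rewrite trajectS inE eqxx.
by rewrite iterS (eqP (next_cycle cyc IHk)) mem_next.
Qed.

(** * Depth and level in an orbit *)

Section Orbit.
Variable v0 : npoint.
Hypothesis v0_pos : positive v0.
Let n := v0.1 + v0.2.
Let O := orbit_set v0.
Implicit Types u v : npoint.

Lemma orbit_base : O v0.
Proof. by exists [::]. Qed.

Lemma orbit_generator g u v : O u -> generator_map g u = Some v -> O v.
Proof.
case=> w wu guv; exists (rcons w g).
by rewrite /apply_word foldl_rcons -/(apply_word w v0) wu /=.
Qed.

(** Since generators follow arcs in both directions, the step is an
    equivalence. *)
Lemma orbit_ind (P : npoint -> Prop) : P v0 ->
  (forall u v, O u -> O v -> positive u -> positive v -> omega_arc u v ->
    (P u <-> P v)) ->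
  forall v, O v -> positive v /\ P v.
Proof.
move=> P0 Parc v [w]; elim/last_ind: w v => [|w g IHw] v; first by case=> <-.
rewrite /apply_word foldl_rcons -/(apply_word w v0).
case wu: (apply_word w v0) => [u|//] /= guv.
have Ou : O u by exists w.
have Ov : O v by apply: orbit_generator guv.
have [pu Pu] := IHw u wu; have [pv uv] := generator_arc pu guv.
by split=> //; case: uv => [uv|vu]; [apply/(Parc u v)|apply/(Parc v u)].
Qed.

Lemma orbit_positive v : O v -> positive v.
Proof. by move=> Ov; have [] := orbit_ind (P := fun _ => True) _ _ Ov. Qed.

Lemma orbit_sum v : O v -> v.1 + v.2 = n.
Proof.
move=> Ov; have [//| |_ //] := orbit_ind (P := fun v => v.1 + v.2 = n) _ _ Ov.
by move=> u w _ _ pu _ uw; have [_ ->] := omega_arc_positive pu uw.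
Qed.

Lemma orbit_lt v : O v -> v.1 < n /\ v.2 < n.
Proof.
by move=> Ov; have := orbit_sum Ov; case/andP: (orbit_positive Ov); lia.
Qed.

Lemma orbit_arc u v : positive u -> omega_arc u v -> O u <-> O v.
Proof.
move=> pu uv; have [[g guv] [g' gvu]] := arc_generators pu uv.
by split=> [Ou|Ov]; [apply: orbit_generator guv|apply: orbit_generator gvu].
Qed.

Lemma finite_orbit : finite_set O.
Proof.
apply: (@sub_finite_set _ _ ((fun x => (x, n - x) : npoint) @` `I_n)); last first.
  exact/finite_image/finite_II.
move=> v Ov; have := orbit_positive Ov; have := orbit_sum Ov.
case: v Ov => x y _ /= + /andP[/= x0 y0] => xy.
by exists x => /=; [lia|congr pair; lia].
Qed.

Lemma orbit_depth v : O v -> depth v = gcdn v.1 n.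
Proof. by move=> Ov; rewrite -(orbit_sum Ov) gcdnDl. Qed.

Let m := logn 2 n.
Let q := n`_2^'.
Let b := (depth v0)`_2^'.
(** The 2-adic valuation of the largest depth. The odd part of the depth is [q]
    exactly when the orbit contains (n/2, n/2), whose depth n/2 has valuation
    m - 1. *)
Let a := if b == q then m.-1 else m.
Let d v := logn 2 (depth v).
Let h v := a - d v.

Lemma n_gt0 : 0 < n.
Proof. by move: v0_pos; rewrite /positive /n; lia. Qed.

Lemma orbit_modulus : n = 2 ^ m * q.
Proof. by rewrite /m -p_part partnC // n_gt0. Qed.

Lemma odd_q : odd q.
Proof. by have := part_pnat 2^' n; rewrite p'natE // dvdn2 negbK. Qed.

Lemma depth_gt0 v : positive v -> 0 < depth v.
Proof. by rewrite /depth gcdn_gt0 => /andP[->]. Qed.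

Lemma odd_b : odd b.
Proof. by have := part_pnat 2^' (depth v0); rewrite p'natE // dvdn2 negbK. Qed.

(** gcd(2x, n) has the valuation of gcd(x, n) plus one, capped by that of n;
    an odd prime does not see the factor 2. *)
Lemma depth_arc u v : O u -> omega_arc u v ->
  d v = minn (d u).+1 m /\ (depth v)`_2^' = (depth u)`_2^'.
Proof.
move=> Ou uv; have pu := orbit_positive Ou; have n0 := n_gt0.
have Ov : O v by apply/(orbit_arc pu uv).
have u1 : 0 < u.1 by case/andP: pu.
rewrite /d (orbit_depth Ou) (orbit_depth Ov) (omega_arc_doubling uv) /=.
rewrite (orbit_sum Ou) gcdn_modl !logn_gcd ?partn_gcd ?muln_gt0 // lognM // -/m.
split; first by rewrite (logn_prime 2 (isT : prime 2)) /=; lia.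
by rewrite odd_part_double.
Qed.

Lemma orbit_odd_depth v : O v -> (depth v)`_2^' = b.
Proof.
move=> Ov; have [//| |_ //] := orbit_ind (P := fun v => (depth v)`_2^' = b) _ _ Ov.
by move=> u w Ou _ _ _ uw; have [_ ->] := depth_arc Ou uw.
Qed.

Lemma orbit_depthE v : O v -> depth v = 2 ^ d v * b.
Proof.
move=> Ov; rewrite -(orbit_odd_depth Ov) -p_part partnC //.
exact/depth_gt0/orbit_positive.
Qed.

Lemma a_le_m : a <= m.
Proof. by rewrite /a; case: ifP => _; rewrite ?leq_pred. Qed.

Lemma q_gt0 : 0 < q. Proof. exact: part_gt0. Qed.
Lemma b_gt0 : 0 < b. Proof. exact: part_gt0. Qed.

(** If b = q, the depth divides n = 2^m b and is less than n, so its valuation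
    cannot be m. *)
Lemma d_le_a v : O v -> d v <= a.
Proof.
move=> Ov; have dE := orbit_depth Ov.
rewrite /a; case: eqP => [bq|_].
  have : depth v < n.
    have := orbit_sum Ov; have /andP[v1 v2] := orbit_positive Ov.
    by have := dvdn_leq v1 (dvdn_gcdl v.1 v.2); rewrite /depth; lia.
  rewrite (orbit_depthE Ov) bq [X in _ < X]orbit_modulus.
  by rewrite ltn_pmul2r ?q_gt0 // ltn_exp2l //; lia.
by apply: dvdn_leq_log n_gt0 _; rewrite dE dvdn_gcdr.
Qed.

(** The only point of the line at which omega is undefined is (n/2, n/2), and
    its depth n/2 has odd part q. *)
Lemma diagonal_bottom v : O v -> v.1 = v.2 -> b = q /\ h v = 0.
Proof.
move=> Ov v12; have nE := orbit_sum Ov.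
have /andP[_ v2] := orbit_positive Ov.
have dE : n = 2 * depth v by rewrite /depth v12 gcdnn -nE v12; lia.
have dv0 := depth_gt0 (orbit_positive Ov).
have bq : b = q.
  by rewrite -(orbit_odd_depth Ov) /q dE odd_part_double.
split=> //; rewrite /h /a bq eqxx /m dE lognM // (logn_prime 2 (isT : prime 2)) /=.
by rewrite /d subnn.
Qed.

(** The depth is then n/2 and divides both coordinates, whose sum is n, so both
    are equal to it. *)
Lemma bottom_diagonal v : O v -> b = q -> h v = 0 -> v.1 = v.2.
Proof.
move=> Ov bq hv.
have da : d v = a by have := d_le_a Ov; move: hv; rewrite /h; lia.
have := orbit_positive Ov; have := orbit_sum Ov; have := orbit_depthE Ov.
rewrite da bq /depth => dE nE /andP[v1 v2].
have aE : a = m.-1 by rewrite /a bq eqxx.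
have /dvdnP[x xE] := dvdn_gcdl v.1 v.2; have /dvdnP[y yE] := dvdn_gcdr v.1 v.2.
move: xE yE; rewrite dE => xE yE.
(* An equality if m > 0; but m = 0 still has to be covered, and then a = 0. *)
have nE2 : n <= 2 * (2 ^ a * q).
  by rewrite orbit_modulus aE; case: (m) => [|k] /=; rewrite ?expnS; lia.
have x0 : 0 < x by move: v1; rewrite xE; case: (x).
have y0 : 0 < y by move: v2; rewrite yE; case: (y).
set c := 2 ^ a * q in xE yE nE2 dE.
have c0 : 0 < c by rewrite muln_gt0 expn_gt0 q_gt0.
have : (x + y) * c <= 2 * c by rewrite mulnDl -xE -yE nE.
rewrite leq_pmul2r // => xy.
have [x1 y1] : x = 1 /\ y = 1 by lia.
by rewrite xE yE x1 y1.
Qed.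

Lemma orbit_omega v : O v -> v.1 != v.2 -> omega v = Some (doubling n v).
Proof. by move=> Ov vd; rewrite omegaE vd (orbit_sum Ov). Qed.

Lemma orbit_even v : O v -> 0 < d v -> ~~ odd v.1 /\ ~~ odd v.2.
Proof.
rewrite /d => Ov; rewrite logn_gt0 mem_primes => /and3P[_ _ /=].
by rewrite /depth dvdn_gcd !dvdn2 => /andP[].
Qed.

Lemma orbit_children v : O v -> children omega_arc O v =
  [set u | ~~ odd v.1 && (u == gamma_val v) || ~~ odd v.2 && (u == delta_val v)].
Proof.
move=> Ov; have pv := orbit_positive Ov; apply/seteqP; split=> u /=.
  by case=> Ou; rewrite omega_arc_preimages ?orbit_positive.
move=> uE; have pu : positive u.
  case: v Ov pv uE => x y Ov /andP[/= x0 y0].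
  by case/orP=> /andP[even /eqP->]; rewrite /positive /=; lia.
have uv : omega_arc u v by rewrite omega_arc_preimages.
by split=> //; apply/(orbit_arc pu uv).
Qed.

Lemma gamma_neq_delta v : positive v -> gamma_val v <> delta_val v.
Proof. by case: v => x y /andP[/= x0 y0] [] /=; lia. Qed.

(** A point of level less than [a] has even depth, so gamma and delta are both
    defined at it; this is the source of the binary branching. *)
Lemma orbit_levelled_forest : levelled_forest omega_arc (doubling n) h a O.
Proof.
have arcE u v : O u -> O v -> 0 < h u -> omega_arc u v = (v == doubling n u).
  move=> Ou Ov hu; have du : u.1 != u.2.
    by apply: contraTneq hu => /(diagonal_bottom Ou)[_ ->].
  by rewrite /omega_arc (orbit_omega Ou du) eq_sym.
split=> //.
- exact: finite_orbit.
- move=> v Ov hv; have dv : v.1 != v.2.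
    by apply: contraTneq hv => /(diagonal_bottom Ov)[_ ->].
  have arc : omega_arc v (doubling n v) by rewrite /omega_arc orbit_omega.
  split; first by apply/(orbit_arc (orbit_positive Ov) arc).
  rewrite /h; have [-> _] := depth_arc Ov arc.
  by move: hv; have := a_le_m; rewrite /h; lia.
- move=> u v Ou Ov hu uv; have [+ _] := depth_arc Ou uv.
  by move: hu; have := a_le_m; rewrite /h; lia.
- move=> u Ou; have pu := orbit_positive Ou; rewrite omega_arc_preimages //.
  case: u Ou pu => x y _ /andP[/= x0 y0].
  by rewrite /gamma_val /delta_val !xpair_eqE /=; lia.
- by move=> v _; apply: leq_subr.
move=> v Ov hv; exists (gamma_val v), (delta_val v).
split; first exact/gamma_neq_delta/orbit_positive.
have [|ev1 ev2] := orbit_even Ov; first by move: hv; rewrite /h; lia.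
rewrite orbit_children // ev1 ev2 /=; apply/seteqP; split=> u /=.
  by case/orP=> /eqP; [left|right].
by case=> ->; rewrite eqxx ?orbT.
Qed.

(** The point where the trajectory of [v0] first meets the bottom. *)
Let y0 := iter (h v0) (doubling n) v0.

Lemma ground_base : O y0 /\ h y0 = 0.
Proof.
have [Oy hy] := iter_up orbit_levelled_forest orbit_base (leqnn (h v0)).
by split=> //; rewrite hy subnn.
Qed.

Lemma bottom_ground : bottom O = [set v | O v /\ h v = 0].
Proof.
have [Oy hy] := ground_base.
have leE u v : O u -> O v -> (depth u <= depth v) = (d u <= d v).
  move=> Ou Ov; rewrite (orbit_depthE Ou) (orbit_depthE Ov).
  by rewrite leq_pmul2r ?b_gt0 // leq_exp2l.
apply/seteqP; split=> v [Ov].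
  move=> /(_ _ Oy); rewrite leE // => dyv.
  by split=> //; move: hy; rewrite /h; lia.
move=> hv; split=> // u Ou; rewrite leE //.
by have := d_le_a Ou; move: hv; rewrite /h; lia.
Qed.

Lemma bottom_depth v : bottom O v -> depth v = 2 ^ a * b.
Proof.
rewrite bottom_ground => -[Ov hv]; rewrite (orbit_depthE Ov).
by congr (2 ^ _ * b); have := d_le_a Ov; move: hv; rewrite /h; lia.
Qed.

Lemma finite_bottom : finite_set (bottom O).
Proof. by apply: sub_finite_set finite_orbit => v []. Qed.

Lemma max_depth_bottom : max_depth (bottom O) = 2 ^ a * b.
Proof.
have By : bottom O y0 by rewrite bottom_ground; apply: ground_base.
apply/eqP; rewrite eqn_leq; apply/andP; split.
  apply/bigmax_leqP_seq => v; rewrite in_fset_set ?inE; last exact: finite_bottom.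
  by move=> Bv _; rewrite bottom_depth.
rewrite -(bottom_depth By); apply: (@leq_bigmax_seq _ _ (fun=> true)) => //.
by rewrite in_fset_set ?inE //; exact: finite_bottom.
Qed.


Lemma ground_up v : O v -> h v = 1 ->
  O (doubling n v) /\ h (doubling n v) = 0 /\ omega_arc v (doubling n v).
Proof.
move=> Ov hv; have [|Of hf] := lf_up orbit_levelled_forest Ov; first by rewrite hv.
rewrite hf hv; split=> //; split=> //.
by rewrite (lf_arc orbit_levelled_forest) ?eqxx ?hv.
Qed.

Lemma ground_child u v : O u -> O v -> h v = 0 -> omega_arc u v -> 0 < h u ->
  h u = 1 /\ doubling n u = v.
Proof.
move=> Ou Ov hv uv hu; have := lf_arc orbit_levelled_forest Ou Ov hu.
rewrite uv => /esym/eqP vE; have := (lf_up orbit_levelled_forest Ou hu).2.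
by rewrite -vE hv; split=> //; lia.
Qed.

(** * The bottom reduced to a point *)

Section PointBottom.
Hypothesis bq : b = q.

Lemma bottom_point : bottom O = [set y0].
Proof.
have [Oy hy] := ground_base; rewrite bottom_ground.
apply/seteqP; split=> [v [Ov hv]|v -> //].
have := bottom_diagonal Ov bq hv; have := bottom_diagonal Oy bq hy.
have := orbit_sum Ov; have := orbit_sum Oy.
case: v {Ov hv} => x x'; case: (y0) => y y' /= sy sx yy xx.
by congr pair; lia.
Qed.

Lemma point_stems : 0 < a ->
  [/\ O (gamma_val y0) /\ O (delta_val y0),
      h (gamma_val y0) = 1 /\ h (delta_val y0) = 1,
      doubling n (gamma_val y0) = y0 /\ doubling n (delta_val y0) = y0
    & forall v, O v -> h v = 1 -> v = gamma_val y0 \/ v = delta_val y0].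
Proof.
move=> a_gt0; have [Oy hy] := ground_base.
have [||ev1 ev2] := @orbit_even y0 => //; first by move: hy; rewrite /h; lia.
have chE := orbit_children Oy; rewrite ev1 ev2 /= in chE.
have stemP v : children omega_arc O y0 v -> [/\ O v, h v = 1 & doubling n v = y0].
  case=> Ov vy; have hv : 0 < h v.
    rewrite lt0n; apply: contraL vy => /eqP hv.
    have : bottom O v by rewrite bottom_ground.
    by rewrite bottom_point => ->; apply: (lf_irrefl orbit_levelled_forest).
  by have [] := ground_child Ov Oy hy vy hv.
have [|? ? ?] := stemP (gamma_val y0); first by rewrite chE /= eqxx.
have [|? ? ?] := stemP (delta_val y0); first by rewrite chE /= eqxx orbT.
split=> // v Ov hv; have [Of [hf vf]] := ground_up Ov hv.
have fE : doubling n v = y0.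
  have : bottom O (doubling n v) by rewrite bottom_ground.
  by rewrite bottom_point.
have : children omega_arc O y0 v by split=> //; rewrite -fE.
by rewrite chE /= => /orP[] /eqP; [left|right].
Qed.

End PointBottom.

(** * The bottom as a cycle *)

Section CycleBottom.
Hypothesis bq : b <> q.
(** A period of doubling modulo q, and so of doubling on the bottom. *)
Let K := totient q.

Lemma cycle_aE : a = m.
Proof. by rewrite /a; case: eqP. Qed.

Lemma cycle_omega v : O v -> omega v = Some (doubling n v).
Proof.
move=> Ov; apply: orbit_omega => //; apply/negP => /eqP v12.
exact: bq (diagonal_bottom Ov v12).1.
Qed.

Lemma cycle_ground v : O v -> h v = 0 -> O (doubling n v) /\ h (doubling n v) = 0.
Proof.
move=> Ov hv; have arc : omega_arc v (doubling n v).
  by rewrite /omega_arc cycle_omega.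
have Of : O (doubling n v) by apply/(orbit_arc (orbit_positive Ov) arc).
by split=> //; apply: (lf_ground orbit_levelled_forest) arc.
Qed.

Lemma cycle_iter_ground k v : O v -> h v = 0 ->
  O (iter k (doubling n) v) /\ h (iter k (doubling n) v) = 0.
Proof.
by move=> Ov hv; elim: k => //= k [Ok hk]; apply: cycle_ground.
Qed.

(** A bottom coordinate x is a multiple of 2^m, and q divides 2^K - 1, so n
    divides 2^K x - x. *)
Lemma cycle_periodic v : O v -> h v = 0 -> iter K (doubling n) v = v.
Proof.
move=> Ov hv; have [v1 v2] := orbit_lt Ov.
have [mx my] : 2 ^ m %| v.1 /\ 2 ^ m %| v.2.
  apply/andP; rewrite -dvdn_gcd -/(depth v) pfactor_dvdn //.
    by have := d_le_a Ov; move: hv; rewrite /h -cycle_aE /d; lia.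
  exact/depth_gt0/orbit_positive.
have modE x : 2 ^ m %| x -> x < n -> (2 ^ K * x) %% n = x.
  move=> mx' xn; rewrite -[RHS](modn_small xn); apply/eqP.
  rewrite eqn_mod_dvd ?leq_pmull ?expn_gt0 //.
  rewrite -[X in _ - X]mul1n -mulnBl [X in X %| _]orbit_modulus mulnC.
  apply: dvdn_mul => //; rewrite -eqn_mod_dvd ?expn_gt0 //.
  by apply/eqP/Euler_exp_totient; rewrite coprime2n odd_q.
by rewrite iter_doubling // !modE //; case: (v).
Qed.

Lemma K_gt0 : 0 < K. Proof. by rewrite totient_gt0 q_gt0. Qed.

(** On the bottom, K - 1 further doublings undo a doubling. *)
Lemma cycle_injective u : O u -> h u = 0 ->
  u = iter K.-1 (doubling n) (doubling n u).
Proof.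
by move=> Ou hu; rewrite -iterSr prednK ?K_gt0 // cycle_periodic.
Qed.

(** The landing point of [v] on the bottom stays on the trajectory of [y0] when
    [v] moves along an arc in either direction: nothing changes above the
    bottom, and on it a step is undone by periodicity. Hence the bottom is one
    cycle and not several. *)
Lemma cycle_reached v : O v ->
  exists k, iter (h v) (doubling n) v = iter k (doubling n) y0.
Proof.
move=> Ov; pose P v := exists k, iter (h v) (doubling n) v = iter k (doubling n) y0.
have [| |_ //] := orbit_ind (P := P) _ _ Ov; first by exists 0.
move=> u w Ou Ow pu pw uw.
have wE : w = doubling n u by rewrite (omega_arc_doubling uw) (orbit_sum Ou).
have [hu|hu] := posnP (h u).
  have hw : h w = 0 by apply: (lf_ground orbit_levelled_forest) uw.
  rewrite /P hu hw /=; split=> -[k kE].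
    by exists k.+1; rewrite wE kE.
  by exists (K.-1 + k); rewrite iterD -kE wE -cycle_injective.
have [_ hw] := lf_up orbit_levelled_forest Ou hu; rewrite -wE in hw.
by rewrite /P hw wE -iterSr prednK.
Qed.

Lemma cycle_bottom : exists c : seq npoint,
  [/\ uniq c, 1 < size c, fcycle (doubling n) c, bottom O = [set` c]
    & forall v, bottom O v <-> exists k, v = iter k (doubling n) y0].
Proof.
have [Oy hy] := ground_base.
have [c [uc cyc cP]] := periodic_orbit_cycle K_gt0 (cycle_periodic Oy hy).
have BP v : bottom O v <-> exists k, v = iter k (doubling n) y0.
  rewrite bottom_ground; split=> [[Ov hv]|[k ->]]; last exact: cycle_iter_ground.
  by have [k] := cycle_reached Ov; rewrite hv /= => vE; exists k.
exists c; split=> //; last by apply/seteqP; split=> v /=; rewrite BP cP.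
have cy : y0 \in c by apply/cP; exists 0.
have := next_cycle cyc cy; case: c cy {cP cyc uc} => [//|x [|//]].
rewrite inE => /eqP <- /=; rewrite eqxx => /eqP yE.
have := lf_irrefl orbit_levelled_forest Oy.
by rewrite /omega_arc cycle_omega // yE eqxx.
Qed.

Lemma cycle_is_dicycle : is_dicycle omega_arc (bottom O).
Proof.
have [c [uc c1 cyc cE BP]] := cycle_bottom.
exists c => //; split=> // u v Bu _; have [Ou _] := Bu.
have cu : u \in c by rewrite cE in Bu.
rewrite /omega_arc cycle_omega // (eqP (next_cycle cyc cu)).
by rewrite eq_sym.
Qed.

(** One of the two children of [rho] is its predecessor on the cycle. The other
    is off the bottom, because doubling is injective there. *)
Lemma cycle_stem rho : O rho -> h rho = 0 -> 0 < a ->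
  exists t, [/\ O t, h t = 1, doubling n t = rho &
    forall t', O t' -> h t' = 1 -> doubling n t' = rho -> t' = t].
Proof.
move=> Orho hrho a_gt0; pose u := iter K.-1 (doubling n) rho.
have [Ou hu] : O u /\ h u = 0 by apply: cycle_iter_ground.
have fu : doubling n u = rho.
  by rewrite -iterS prednK ?K_gt0 // cycle_periodic.
have [w [wu chE]] : exists w, w <> u /\ children omega_arc O rho = [set u; w].
  have [|x [y [xy chE]]] := lf_fork orbit_levelled_forest Orho; first by rewrite hrho.
  have : children omega_arc O rho u by split=> //; rewrite /omega_arc cycle_omega // fu.
  rewrite chE => -[uE|uE].
    by exists y; rewrite uE; split=> // yx; apply: xy.
  by exists x; rewrite uE setUC; split.
have : children omega_arc O rho w by rewrite chE; right.
case=> Ow wrho; have hw : 0 < h w.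
  rewrite lt0n; apply/negP => /eqP hw; apply: wu.
  rewrite (cycle_injective Ow hw) /u; congr iter.
  by rewrite (omega_arc_doubling wrho) (orbit_sum Ow).
have [hw1 fw] := ground_child Ow Orho hrho wrho hw.
exists w; split=> // t' Ot' ht' ft'.
have : children omega_arc O rho t'.
  by split=> //; rewrite /omega_arc cycle_omega // ft'.
by rewrite chE => -[t'E|//]; rewrite t'E hu in ht'.
Qed.

End CycleBottom.

(** * Decomposition of the orbit into cycle and trees *)

Let decomposed := exists k (root : 'I_k -> npoint) (tree : 'I_k -> set npoint),
  [/\ cycle_with_trees omega_arc O (bottom O) root tree,
      1 < ncard (bottom O) -> forall v, bottom O v -> exists! i, root i = v,
      ncard (bottom O) = 1 -> k = 2,
      forall i, extended_complete_binary_tree omega_arc (tree i) (root i) /\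
                has_height omega_arc (tree i) (root i) a
    & (1 < ncard (bottom O) -> ncard O = ncard (bottom O) * 2 ^ a) /\
      (ncard (bottom O) = 1 -> ncard O = 2 ^ a.+1 - 1)].

Lemma point_decomposed : b = q -> decomposed.
Proof.
move=> bq; have [Oy hy] := ground_base; have F := orbit_levelled_forest.
pose root (i : 'I_2) := y0.
pose stem (i : 'I_2) := if val i == 0 then gamma_val y0 else delta_val y0.
have rootP i : O (root i) /\ h (root i) = 0 by [].
have stemP : 0 < a -> forall i,
    [/\ O (stem i), h (stem i) = 1 & doubling n (stem i) = root i].
  move=> /(point_stems bq)[[? ?] [? ?] [? ?] _] i.
  by rewrite /stem; case: eqP.
have stem_inj : 0 < a -> injective stem.
  have gd := gamma_neq_delta (orbit_positive Oy).
  move=> _ [[|[|//]] hi] [[|[|//]] hj]; rewrite /stem /= => gdE;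
    by [exact: val_inj|case: gd].
have cover v : O v -> h v = 1 -> exists i, v = stem i.
  move=> Ov hv; have a_gt0 : 0 < a by have := lf_height F Ov; rewrite hv.
  have [_ _ _ /(_ v Ov hv)[->|->]] := point_stems bq a_gt0.
    by exists ord0.
  by exists ord_max.
have B1 : ncard (bottom O) = 1 by rewrite bottom_point // ncard_set1.
exists 2, root, (fun i => branch (doubling n) h O (root i) (stem i)).
rewrite B1; split=> //.
- rewrite bottom_ground;
  apply: (forest_cycle_with_trees F rootP stemP stem_inj cover); right.
  exists y0; last exact: (lf_irrefl F).
  by rewrite -bottom_ground bottom_point.
- move=> i; have [Or hr] := rootP i.
  by have [] := branch_tree F Or hr (fun a_gt0 => stemP a_gt0 i).
split=> // _; rewrite (ncard_forest F stemP stem_inj cover) -bottom_ground B1.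
by rewrite expnS; have := expn_gt0 2 a; lia.
Qed.

Lemma cycle_decomposed : b <> q -> decomposed.
Proof.
move=> bq; have [Oy hy] := ground_base; have F := orbit_levelled_forest.
have [c [uc c1 _ cE _]] := cycle_bottom bq.
pose root (i : 'I_(size c)) := nth y0 c i.
have rootB i : bottom O (root i) by rewrite cE /=; apply: mem_nth.
have rootP i : O (root i) /\ h (root i) = 0.
  by have := rootB i; rewrite bottom_ground.
have rootS v : bottom O v -> exists i, root i = v.
  rewrite cE /= => cv; have ltc : index v c < size c by rewrite index_mem.
  by exists (Ordinal ltc); rewrite /root /= nth_index.
have root_inj : injective root.
  by move=> i j /eqP; rewrite nth_uniq // => /eqP/val_inj.
have /choice[stem stemU] : forall i, exists t, 0 < a ->
    [/\ O t, h t = 1, doubling n t = root i &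
    forall t', O t' -> h t' = 1 -> doubling n t' = root i -> t' = t].
  move=> i; have [Or hr] := rootP i; have [a0|a_gt0] := posnP a; first by exists y0.
  by have [t tP] := cycle_stem bq Or hr a_gt0; exists t.
have stemP : 0 < a -> forall i,
    [/\ O (stem i), h (stem i) = 1 & doubling n (stem i) = root i].
  by move=> a_gt0 i; have [] := stemU i a_gt0.
have stem_inj : 0 < a -> injective stem.
  move=> a_gt0 i j ij; apply: root_inj.
  have [_ _ fi] := stemP a_gt0 i; have [_ _ fj] := stemP a_gt0 j.
  by rewrite -fi -fj ij.
have cover v : O v -> h v = 1 -> exists i, v = stem i.
  move=> Ov hv; have a_gt0 : 0 < a by have := lf_height F Ov; rewrite hv.
  have [Of [hf _]] := ground_up Ov hv.
  have [|i iE] := rootS (doubling n v); first by rewrite bottom_ground.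
  by exists i; have [_ _ _ stemi] := stemU i a_gt0; apply: stemi.
have Bc : ncard (bottom O) = size c by rewrite cE ncard_seq.
exists (size c), root, (fun i => branch (doubling n) h O (root i) (stem i)).
rewrite Bc; split=> //.
- rewrite bottom_ground;
  apply: (forest_cycle_with_trees F rootP stemP stem_inj cover); left.
  by rewrite -bottom_ground; apply: cycle_is_dicycle.
- move=> _ v /rootS[i iE]; exists i; split=> // j jE.
  by apply: root_inj; rewrite iE jE.
- by move=> cardc; rewrite cardc in c1.
- move=> i; have [Or hr] := rootP i.
  by have [] := branch_tree F Or hr (fun a_gt0 => stemP a_gt0 i).
split=> [_|cardc]; last by rewrite cardc in c1.
rewrite (ncard_forest F stemP stem_inj cover) -bottom_ground Bc.
by have := expn_gt0 2 a; nia.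
Qed.

Lemma orbit_decomposed : decomposed.
Proof.
by have [bq|bq] := eqVneq b q; [apply: point_decomposed|apply/cycle_decomposed/eqP].
Qed.

Lemma odd_modulus : odd n = (m == 0).
Proof.
by rewrite -[odd n]negbK -dvdn2 -[2]expn1 pfactor_dvdn ?n_gt0 // lt0n negbK.
Qed.

(** For odd n the valuation is always 0, so every point is on the bottom cycle,
    in particular [v0]. *)
Lemma bottom_doublings : odd n ->
  O = bottom O /\ bottom O = [set v | exists j, v = iter j (doubling n) v0].
Proof.
rewrite odd_modulus => /eqP m0.
have h0 v : h v = 0 by have := a_le_m; rewrite /h m0; lia.
have OB : O = bottom O.
  by rewrite bottom_ground; apply/seteqP; split=> [v Ov|v []//]; split.
split=> //; have bq : b <> q.
  move=> bq; have := bottom_diagonal orbit_base bq (h0 v0) => v12.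
  have : odd n by rewrite odd_modulus m0.
  by rewrite /n v12 addnn odd_double.
have [c [_ _ _ _ BP]] := cycle_bottom bq.
by apply/seteqP; split=> v; rewrite BP /y0 h0.
Qed.

(** For even n, either a stem lies outside the bottom, or the bottom is
    (n/2, n/2) and then the doublings of [v0] modulo n include (0, 0), which is
    not in the orbit. *)
Lemma doublings_odd :
  O = bottom O -> bottom O = [set v | exists j, v = iter j (doubling n) v0] ->
  odd n.
Proof.
move=> OB BE; rewrite odd_modulus; case: eqP => // /eqP; rewrite -lt0n => m_gt0.
have h0 v : O v -> h v = 0 by rewrite OB bottom_ground => -[].
have [bq|bq] := eqVneq b q.
  have [v01 v02] := orbit_lt orbit_base.
  have : O (iter m (doubling n) v0) by rewrite OB BE; exists m.
  move/orbit_positive; rewrite iter_doubling // /positive /= [X in _ %% X]orbit_modulus.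
  suff : 2 ^ m * q %| 2 ^ m * v0.1 by move=> /eqP ->.
  apply: dvdn_mul => //; rewrite -bq.
  exact: dvdn_trans (dvdn_part _ _) (dvdn_gcdl _ _).
have [Oy hy] := ground_base; move/eqP: bq => bq.
have a_gt0 : 0 < a by rewrite cycle_aE.
have [t [Ot ht _ _]] := cycle_stem bq Oy hy a_gt0.
by rewrite h0 in ht.
Qed.

Lemma orbit_structure :
  let B := bottom O in
  finite_set O /\
  exists (k : nat) (root : 'I_k -> npoint) (tree : 'I_k -> set npoint),
    [/\ cycle_with_trees omega_arc O B root tree,
        1 < ncard B -> forall v, B v -> exists! i, root i = v,
        ncard B = 1 -> k = 2
      & exists a b : nat,
        [/\ odd b /\ max_depth B = 2 ^ a * b,
            1 < ncard O -> forall i,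
              extended_complete_binary_tree omega_arc (tree i) (root i) /\
              has_height omega_arc (tree i) (root i) a,
            (O = B /\ B = [set v | exists j, v = iter j (doubling n) v0])
            <-> odd n
          & (1 < ncard B -> ncard O = ncard B * 2 ^ a) /\
            (ncard B = 1 -> ncard O = 2 ^ a.+1 - 1)]].
Proof.
move=> B; split; first exact: finite_orbit.
have [k [root [tree [cwt rootU k2 trees cards]]]] := orbit_decomposed.
exists k, root, tree; split=> //; exists a, b; split=> //.
  by split; [exact: odd_b|exact: max_depth_bottom].
by split=> [[]|]; [exact: doublings_odd|exact: bottom_doublings].
Qed.

End Orbit.

Theorem theorem2p6 (r s : nat) (hr : 0 < r) (hs : 0 < s) :
  let O := orbit_set (r, s) in
  let B := bottom O in
  finite_set O /\
  exists (k : nat) (root : 'I_k -> npoint) (tree : 'I_k -> set npoint),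
    [/\ cycle_with_trees omega_arc O B root tree,
        1 < ncard B -> forall v, B v -> exists! i, root i = v,
        ncard B = 1 -> k = 2
      & exists a b : nat,
        [/\ odd b /\ max_depth B = 2 ^ a * b,
            (* (i) *)
            1 < ncard O -> forall i,
              extended_complete_binary_tree omega_arc (tree i) (root i) /\
              has_height omega_arc (tree i) (root i) a,
            (* (ii) *)
            (O = B /\
             B = [set v | exists j : nat,
                  v = ((2 ^ j * r) %% (r + s), (2 ^ j * s) %% (r + s))])
            <-> odd (r + s)
          & (* (iii) *)
            (1 < ncard B -> ncard O = ncard B * 2 ^ a) /\
            (ncard B = 1 -> ncard O = 2 ^ a.+1 - 1)]].
Proof.
have pos : positive (r, s) by rewrite /positive /= hr hs.
have -> : [set v | exists j, v = ((2 ^ j * r) %% (r + s), (2 ^ j * s) %% (r + s))]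
    = [set v | exists j, v = iter j (doubling (r + s)) (r, s)].
  apply/seteqP; split=> v [j ->]; exists j.
    by rewrite iter_doubling //=; lia.
  by rewrite iter_doubling //=; lia.
exact: orbit_structure pos.
Qed.
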